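(* $\dim_{\mathbb{k}} \mathrm{Cl}_q(n,k) = (8k)^n$.
   Context: Let $\mathbb{k}$ be a field of characteristic different from $2$, let $q\in\mathbb{k}^\times$, and let $n,k$ be positive integers. The quantum Clifford algebra $\mathrm{Cl}_q(n,k)$ is the unital associative $\mathbb{k}$-algebra generated by $\psi_a,\psi_a^*,\omega_a,\omega_a^{-1}$ for $a\in\{1,\dots,n\}$, subject to the relations (for all $a,b\in\{1,\dots,n\}$): $\omega_a\omega_b=\omega_b\omega_a$; $\omega_a\omega_a^{-1}=1$; $\omega_a\psi_b=q^{\delta_{ab}}\psi_b\omega_a$; $\omega_a\psi_b^*=q^{-\delta_{ab}}\psi_b^*\omega_a$; $\psi_a\psi_b+\psi_b\psi_a=0$; $\psi_a^*\psi_b^*+\psi_b^*\psi_a^*=0$; $\psi_a\psi_a^*+q^k\psi_a^*\psi_a=\omega_a^{-k}$; $\psi_a\psi_a^*+q^{-k}\psi_a^*\psi_a=\omega_a^{k}$; and $\psi_a\psi_b^*+\psi_b^*\psi_a=0$ if $a\neq b$. *)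

(* Defs.v *)
(* Quantum Clifford algebra Cl_q(n,k) presented by generators
   and relations, realised as the free associative algebra (formal linear
   combinations of words in the generators) modulo the two-sided ideal
   generated by the relations. *)
From mathcomp Require Import all_boot all_algebra.
Set Implicit Arguments. Unset Strict Implicit. Unset Printing Implicit Defensive.
Import GRing.Theory.
Local Open Scope ring_scope.

Section FreeAlg.
Variables (K : fieldType) (n : nat).

(* generator (a, t): t = 0 : psi_a, 1 : psi_a^*, 2 : omega_a, 3 : omega_a^{-1} *)
Definition gen := ('I_n * 'I_4)%type.
Definition word := seq gen.
(* an element of the free algebra K<gen> as a formal linear combination of words *)
Definition ncpoly := seq (K * word).

Definition coef (p : ncpoly) (w : word) : K := \sum_(t <- p | t.2 == w) t.1.
Definition nceq (p r : ncpoly) : Prop := forall w, coef p w = coef r w.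

Definition nczero : ncpoly := [::].
Definition ncone : ncpoly := [:: (1, [::])].
Definition ncadd (p r : ncpoly) : ncpoly := p ++ r.
Definition ncscale (c : K) (p : ncpoly) : ncpoly := [seq (c * t.1, t.2) | t <- p].
Definition ncopp (p : ncpoly) : ncpoly := ncscale (-1) p.
Definition ncsub (p r : ncpoly) : ncpoly := ncadd p (ncopp r).
Definition ncmul (p r : ncpoly) : ncpoly :=
  [seq (x.1 * y.1, x.2 ++ y.2) | x <- p, y <- r].
Definition ncpow (p : ncpoly) (m : nat) : ncpoly := iter m (ncmul p) ncone.
Definition ncgen (g : gen) : ncpoly := [:: (1, [:: g])].
Definition ncsum (ps : seq ncpoly) : ncpoly := flatten ps.

Definition in_ideal (rels : seq ncpoly) (p : ncpoly) : Prop :=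
  exists s : seq (K * word * ncpoly * word),
    all (fun t => t.1.2 \in rels) s /\
    nceq p (ncsum [seq ncscale t.1.1.1
                     (ncmul (ncmul [:: (1, t.1.1.2)] t.1.2) [:: (1, t.2)]) | t <- s]).

Definition quotient_dim_eq (rels : seq ncpoly) (N : nat) : Prop :=
  exists b : 'I_N -> ncpoly,
    (forall p : ncpoly, exists c : 'I_N -> K,
        in_ideal rels (ncsub p (ncsum [seq ncscale (c i) (b i) | i <- enum 'I_N])))
    /\
    (forall c : 'I_N -> K,
        in_ideal rels (ncsum [seq ncscale (c i) (b i) | i <- enum 'I_N]) ->
        forall i, c i = 0).

End FreeAlg.

Section Clifford.
Variables (K : fieldType) (n k : nat) (q : K).

Definition t0 : 'I_4 := @Ordinal 4 0 isT.
Definition t1 : 'I_4 := @Ordinal 4 1 isT.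
Definition t2 : 'I_4 := @Ordinal 4 2 isT.
Definition t3 : 'I_4 := @Ordinal 4 3 isT.

Definition psi (a : 'I_n) : ncpoly K n := ncgen K (a, t0).
Definition psis (a : 'I_n) : ncpoly K n := ncgen K (a, t1).
Definition om (a : 'I_n) : ncpoly K n := ncgen K (a, t2).
Definition omi (a : 'I_n) : ncpoly K n := ncgen K (a, t3).

Declare Scope nc_scope.
Local Notation "x * y" := (ncmul x y) : nc_scope.
Local Notation "x + y" := (ncadd x y) : nc_scope.
Local Notation "x - y" := (ncsub x y) : nc_scope.
Local Notation "c *: x" := (ncscale c x) : nc_scope.
Delimit Scope nc_scope with NC.

Definition cl_rels_ab (a b : 'I_n) : seq (ncpoly K n) :=
  [:: (om a * om b - om b * om a)%NC;
      (om a * omi a - ncone K n)%NC;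
      (om a * psi b - (q ^+ (a == b)) *: (psi b * om a))%NC;
      (om a * psis b - (q ^+ (a == b))^-1 *: (psis b * om a))%NC;
      (psi a * psi b + psi b * psi a)%NC;
      (psis a * psis b + psis b * psis a)%NC;
      (psi a * psis a + (q ^+ k) *: (psis a * psi a) - ncpow (omi a) k)%NC;
      (psi a * psis a + (q ^+ k)^-1 *: (psis a * psi a) - ncpow (om a) k)%NC] ++
  (if a != b then [:: (psi a * psis b + psis b * psi a)%NC] else [::]).

Definition cl_rels : seq (ncpoly K n) :=
  flatten [seq cl_rels_ab a b | a <- enum 'I_n, b <- enum 'I_n].

End Clifford.

(* Main.v *)
(* Put e = psi_a psi_a^* and f = psi_a^* psi_a.  Since psi_a and psi_a^* square
   to zero, e f = f e = 0, so the two mixed relations give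
   1 = omega_a^k omega_a^-k = e^2 + f^2 and psi_a^* omega_a^2k = psi_a^*,
   psi_a omega_a^2k = q^-2k psi_a.  Hence at each site the 8k words
   psi omega^i, psi^* omega^i, psi psi^* omega^i, psi^* psi omega^i (i < 2k)
   span, left multiplication by psi, psi^*, omega sending each of them to a
   multiple of another; generators at distinct sites commute up to sign, so the
   products over all sites of these words span the algebra.

   For independence, at one site the algebra acts on two copies of the group
   algebra of Z/2k, with basis (e, j), (f, j): omega raises j by one (with a
   factor q^-1 on the second copy), psi^* maps (e, j) to (f, j) and psi maps
   (f, j) to (e, j + k).  With Jordan-Wigner signs this extends to all sites; the
   basis words act by monomial matrices whose nonzero entries lie in disjoint
   places. *)
Require Import Defs.
From mathcomp Require Import all_boot all_algebra.
From mathcomp Require Import ring.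
Set Implicit Arguments. Unset Strict Implicit. Unset Printing Implicit Defensive.
Import GRing.Theory.
Local Open Scope ring_scope.

(** * Ideal membership tested by functionals on words *)

Section Ideal.
Variables (K : fieldType) (n : nat).
Implicit Types (p r : ncpoly K n) (phi : word n -> K) (u v w : word n).

Definition pairing phi p : K := \sum_(t <- p) t.1 * phi t.2.

Lemma pairing_cat phi p r : pairing phi (p ++ r) = pairing phi p + pairing phi r.
Proof. exact: big_cat. Qed.

Lemma pairing_add phi p r :
  pairing phi (ncadd p r) = pairing phi p + pairing phi r.
Proof. exact: pairing_cat. Qed.

Lemma pairing_scale phi c p : pairing phi (ncscale c p) = c * pairing phi p.
Proof.
by rewrite /pairing big_map mulr_sumr; apply: eq_bigr => t _; rewrite mulrA.
Qed.

Lemma pairing_sub phi p r :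
  pairing phi (ncsub p r) = pairing phi p - pairing phi r.
Proof. by rewrite pairing_add pairing_scale mulN1r. Qed.

Lemma pairing_mul phi p r :
  pairing phi (ncmul p r) =
  pairing (fun v => pairing (fun w => phi (v ++ w)) r) p.
Proof.
rewrite /pairing /ncmul big_allpairs_dep; apply: eq_bigr => x _.
by rewrite mulr_sumr; apply: eq_bigr => y _; rewrite mulrA.
Qed.

Lemma pairing1 phi c w : pairing phi [:: (c, w)] = c * phi w.
Proof. exact: big_seq1. Qed.

Lemma pairing_one phi : pairing phi (ncone K n) = phi [::].
Proof. by rewrite pairing1 mul1r. Qed.

Lemma pairing_gen phi g : pairing phi (ncgen K g) = phi [:: g].
Proof. by rewrite pairing1 mul1r. Qed.

Lemma pairing_pow phi g m : pairing phi (ncpow (ncgen K g) m) = phi (nseq m g).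
Proof.
elim: m phi => [|m IHm] phi; first exact: pairing_one.
by rewrite [ncpow _ _]/= pairing_mul pairing_gen IHm.
Qed.

Lemma pairing_sum phi (ps : seq (ncpoly K n)) :
  pairing phi (ncsum ps) = \sum_(p <- ps) pairing phi p.
Proof.
elim: ps => [|p ps IH]; first by rewrite /pairing !big_nil.
by rewrite big_cons -IH -pairing_cat.
Qed.

Lemma coefE p w : coef p w = pairing (fun v => (v == w)%:R) p.
Proof.
by rewrite /coef big_mkcond; apply: eq_bigr => t _; case: eqP; rewrite ?mulr1 ?mulr0.
Qed.

(** Grouping the terms of both polynomials by word, over a common duplicate-free list, shows that a
    pairing depends on the coefficients alone. Conversely, each coefficient is the pairing with an
    indicator function. *)
Lemma nceqP p r : nceq p r <-> forall phi, pairing phi p = pairing phi r.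
Proof.
split=> [eq_pr phi | eq_pr w]; last by rewrite !coefE.
pose s := undup ([seq t.2 | t <- p] ++ [seq t.2 | t <- r]).
suff expand z : {subset [seq t.2 | t <- z] <= s} ->
    pairing phi z = \sum_(w <- s) coef z w * phi w.
  rewrite !expand; first by apply: eq_bigr => w _; rewrite eq_pr.
    by move=> w hw; rewrite mem_undup mem_cat hw orbT.
  by move=> w hw; rewrite mem_undup mem_cat hw.
move=> zs; under eq_bigr => w _ do rewrite /coef mulr_suml.
rewrite (exchange_big_dep xpredT) //= /pairing big_seq [RHS]big_seq.
apply: eq_bigr => t tz; have ts : t.2 \in s by apply/zs/map_f.
rewrite big_mkcond (bigD1_seq _ ts) ?undup_uniq //= eqxx big1 ?addr0 //.
by move=> w /negPf; rewrite eq_sym => ->.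
Qed.

Variable rels : seq (ncpoly K n).

(* An element of the free algebra is encoded by the map sending a functional
   [phi] on words to its value; this spares normal forms of [ncpoly]. *)
Definition idl (F : (word n -> K) -> K) : Prop :=
  exists s : seq (K * word n * ncpoly K n * word n),
    all (fun t => t.1.2 \in rels) s /\
    forall phi, F phi = \sum_(t <- s)
      t.1.1.1 * pairing (fun w => phi (t.1.1.2 ++ w ++ t.2)) t.1.2.

Lemma in_idealE p : in_ideal rels p <-> idl (fun phi => pairing phi p).
Proof.
have E phi s : pairing phi (ncsum [seq ncscale t.1.1.1
      (ncmul (ncmul [:: (1, t.1.1.2)] t.1.2) [:: (1, t.2)]) | t <- s]) =
    \sum_(t <- s) t.1.1.1 * pairing (fun w => phi (t.1.1.2 ++ w ++ t.2)) t.1.2.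
  rewrite pairing_sum big_map; apply: eq_bigr => t _.
  rewrite pairing_scale !pairing_mul pairing1 mul1r; congr (_ * _).
  by apply: eq_bigr => x _; rewrite pairing1 mul1r catA.
split=> [[s [hs /nceqP eq_ps]] | [s [hs eq_ps]]]; exists s; split=> //.
  by move=> phi; rewrite eq_ps E.
by apply/nceqP=> phi; rewrite eq_ps E.
Qed.

Lemma idl_ext F G : idl F -> (forall phi, G phi = F phi) -> idl G.
Proof. by case=> s [hs eF] eG; exists s; split=> // phi; rewrite eG. Qed.

Lemma idl0 : idl (fun=> 0).
Proof. by exists [::]; split=> // phi; rewrite big_nil. Qed.

Lemma idlD F G : idl F -> idl G -> idl (fun phi => F phi + G phi).
Proof.
move=> [s [hs eF]] [s' [hs' eG]]; exists (s ++ s'); split.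
  by rewrite all_cat hs hs'.
by move=> phi; rewrite big_cat /= eF eG.
Qed.

Lemma idlZ c F : idl F -> idl (fun phi => c * F phi).
Proof.
move=> [s [hs eF]].
exists [seq (c * t.1.1.1, t.1.1.2, t.1.2, t.2) | t <- s]; split.
  by rewrite all_map.
move=> phi; rewrite eF big_map mulr_sumr.
by apply: eq_bigr => t _; rewrite mulrA.
Qed.

Lemma idl_ctx u v F : idl F -> idl (fun phi => F (fun w => phi (u ++ w ++ v))).
Proof.
move=> [s [hs eF]].
exists [seq (t.1.1.1, u ++ t.1.1.2, t.1.2, t.2 ++ v) | t <- s]; split.
  by rewrite all_map.
move=> phi; rewrite eF big_map; apply: eq_bigr => t _; congr (_ * _).
by apply: eq_bigr => x _; rewrite /= !catA.
Qed.

Lemma idl_rel p : p \in rels -> idl (fun phi => pairing phi p).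
Proof.
move=> hp; exists [:: (1, [::], p, [::])]; split; first by rewrite /= hp.
move=> phi; rewrite big_seq1 mul1r.
by apply: eq_bigr => x _; rewrite /= cats0.
Qed.

(** The scalar may be zero: [monred w 0 w'], with any [w'], expresses that [w] vanishes in the
    quotient. *)
Definition monred w c w' := idl (fun phi => phi w - c * phi w').

Lemma monred_refl w : monred w 1 w.
Proof. by apply: (idl_ext idl0) => phi; ring. Qed.

Lemma monred_trans w2 c1 c2 w1 w3 :
  monred w1 c1 w2 -> monred w2 c2 w3 -> monred w1 (c1 * c2) w3.
Proof.
move=> h1 h2; apply: (idl_ext (idlD h1 (idlZ c1 h2))) => phi; ring.
Qed.

Lemma monred_ctx u v w c w' : monred w c w' -> monred (u ++ w ++ v) c (u ++ w' ++ v).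
Proof. exact: idl_ctx. Qed.

Lemma monred_ctxl u w c w' : monred w c w' -> monred (u ++ w) c (u ++ w').
Proof. by move/(monred_ctx u [::]); rewrite !cats0. Qed.

Lemma monred_ctxr v w c w' : monred w c w' -> monred (w ++ v) c (w' ++ v).
Proof. exact: (monred_ctx [::]). Qed.

Lemma monred_sym w c w' : c != 0 -> monred w c w' -> monred w' c^-1 w.
Proof.
move=> c0 h; apply: (idl_ext (idlZ (- c^-1) h)) => phi; field; exact: c0.
Qed.

(** Two terms are needed for the mixed relations, which make the [k]-th powers of [omega] and its
    inverse sums of two words. *)
Definition birel w c1 w1 c2 w2 :=
  idl (fun phi => phi w - (c1 * phi w1 + c2 * phi w2)).

Lemma birel_monred w c1 w1 c2 w2 d1 v1 d2 v2 :
  birel w c1 w1 c2 w2 -> monred w1 d1 v1 -> monred w2 d2 v2 ->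
  birel w (c1 * d1) v1 (c2 * d2) v2.
Proof.
move=> h h1 h2.
by apply: (idl_ext (idlD h (idlD (idlZ c1 h1) (idlZ c2 h2)))) => phi; ring.
Qed.

Lemma birel_ctx u v w c1 w1 c2 w2 : birel w c1 w1 c2 w2 ->
  birel (u ++ w ++ v) c1 (u ++ w1 ++ v) c2 (u ++ w2 ++ v).
Proof. exact: (@idl_ctx u v (fun phi => _)). Qed.

Lemma birel0r w c1 w1 c2 w2 w3 : birel w c1 w1 c2 w2 -> monred w2 0 w3 ->
  monred w c1 w1.
Proof.
move=> h h2; apply: (idl_ext (idlD h (idlZ c2 h2))) => phi; ring.
Qed.

Lemma birel0l w c1 w1 c2 w2 w3 : birel w c1 w1 c2 w2 -> monred w1 0 w3 ->
  monred w c2 w2.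
Proof.
move=> h h2; apply: (idl_ext (idlD h (idlZ c1 h2))) => phi; ring.
Qed.

(** * Spanning families of words in the quotient *)

Section Span.
Variables (T : finType) (W : T -> word n).

Definition spanned F := exists c : T -> K,
  idl (fun phi => F phi - \sum_i c i * phi (W i)).

Lemma spanned_basis i : spanned (fun phi => phi (W i)).
Proof.
exists (fun j => (j == i)%:R); apply: (idl_ext idl0) => phi.
rewrite (bigD1 i) //= eqxx mul1r big1 ?addr0 ?subrr // => j /negPf ->.
by rewrite mul0r.
Qed.

Lemma spanned0 : spanned (fun=> 0).
Proof.
exists (fun=> 0); apply: (idl_ext idl0) => phi.
by rewrite big1 ?subrr // => i _; rewrite mul0r.
Qed.

Lemma spannedD F G :
  spanned F -> spanned G -> spanned (fun phi => F phi + G phi).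
Proof.
move=> [c hc] [d hd]; exists (fun i => c i + d i).
apply: (idl_ext (idlD hc hd)) => phi.
under eq_bigr => i _ do rewrite mulrDl.
by rewrite big_split /=; ring.
Qed.

Lemma spannedZ a F : spanned F -> spanned (fun phi => a * F phi).
Proof.
move=> [c hc]; exists (fun i => a * c i).
apply: (idl_ext (idlZ a hc)) => phi.
under eq_bigr => i _ do rewrite -mulrA.
by rewrite -mulr_sumr; ring.
Qed.

Lemma spanned_ext F G : spanned F -> (forall phi, G phi = F phi) -> spanned G.
Proof.
by move=> [c hc] e; exists c; apply: (idl_ext hc) => phi; rewrite e.
Qed.

Lemma spanned_cong F G :
  spanned F -> idl (fun phi => G phi - F phi) -> spanned G.
Proof.
move=> [c hc] e; exists c; apply: (idl_ext (idlD hc e)) => phi; ring.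
Qed.

Lemma spanned_monred w c w' :
  monred w c w' -> spanned (fun phi => phi w') -> spanned (fun phi => phi w).
Proof. by move=> h /(spannedZ c)/spanned_cong; apply. Qed.

Lemma spanned_birel w c1 w1 c2 w2 : birel w c1 w1 c2 w2 ->
  spanned (fun phi => phi w1) -> spanned (fun phi => phi w2) ->
  spanned (fun phi => phi w).
Proof.
move=> h /(spannedZ c1) h1 /(spannedZ c2) h2.
exact: (spanned_cong (spannedD h1 h2)).
Qed.

Lemma spanned_sum (I : eqType) (s : seq I) (c : I -> K) (w_ : I -> word n) :
  {in s, forall i, spanned (fun phi => phi (w_ i))} ->
  spanned (fun phi => \sum_(i <- s) c i * phi (w_ i)).
Proof.
elim: s => [|i s IHs] hs.
  by apply: (spanned_ext spanned0) => phi; rewrite big_nil.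
apply: (@spanned_ext (fun phi => c i * phi (w_ i) + \sum_(j <- s) c j * phi (w_ j))).
  apply: spannedD; first by apply/spannedZ/hs/mem_head.
  by apply: IHs => j js; apply: hs; rewrite inE js orbT.
by move=> phi; rewrite big_cons.
Qed.

(** Since the ideal is stable under left multiplication, spanning can be proved one letter at a
    time, looking only at products of a generator with a basis word. *)
Lemma spanned_left g :
  (forall i, spanned (fun phi => phi (g :: W i))) ->
  forall w, spanned (fun phi => phi w) -> spanned (fun phi => phi (g :: w)).
Proof.
move=> hg w [c /(idl_ctx [:: g] [::]) hc].
have h := @spanned_sum _ (index_enum T) c (fun i => g :: W i) (fun i _ => hg i).
apply: (spanned_cong h); apply: (idl_ext hc) => phi /=; rewrite cats0.
by congr (_ - _); apply: eq_bigr => i _; rewrite cats0.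
Qed.

Lemma quotient_dim_words (N : nat) : #|T| = N ->
  (forall w, spanned (fun phi => phi w)) ->
  (forall c : T -> K, idl (fun phi => \sum_i c i * phi (W i)) ->
     forall i, c i = 0) ->
  quotient_dim_eq rels N.
Proof.
move=> cardT hspan hfree; case: N / cardT.
have E phi (c : T -> K) :
    pairing phi (ncsum [seq ncscale (c (enum_val j)) [:: (1, W (enum_val j))]
                       | j <- enum 'I_#|T|]) = \sum_i c i * phi (W i).
  rewrite pairing_sum big_map big_enum /= (reindex _ (onW_bij _ (@enum_rank_bij T))) /=.
  apply: eq_bigr => i _.
  by rewrite enum_rankK pairing1 mulr1.
exists (fun j => [:: (1, W (enum_val j))]); split=> [p | c].
  (* The terms of [p], pairs of a scalar and a word, serve as their own summation index. *)
  have hp : {in p, forall t : K * word n, spanned (fun phi => phi t.2)}.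
    by move=> t _; apply: hspan.
  have [c hc] := spanned_sum (fun t => t.1) hp.
  exists (fun j => c (enum_val j)); apply/in_idealE.
  by apply: (idl_ext hc) => phi; rewrite pairing_sub E.
move=> /in_idealE hc j.
rewrite -(enum_valK j); apply: (hfree (fun i => c (enum_rank i))).
apply: (idl_ext hc) => phi; rewrite -E; congr (pairing _ (ncsum _)).
by apply: eq_map => i; rewrite enum_valK.
Qed.

End Span.
End Ideal.

(** * Consequences of the defining relations *)

Section Relations.
Variables (K : fieldType) (n k : nat) (q : K).
Hypotheses (two_neq0 : (2%:R : K) != 0) (q_neq0 : q != 0) (k_gt0 : (0 < k)%N).

Local Notation P a := ((a, t0) : gen n).
Local Notation Q a := ((a, t1) : gen n).
Local Notation O a := ((a, t2) : gen n).
Local Notation H a := ((a, t3) : gen n).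
Local Notation rels := (cl_rels n k q).
Local Notation monred := (monred rels).
Local Notation birel := (birel rels).
Implicit Types (a b : 'I_n) (w : word n).

Lemma mem_cl_rels a b p : p \in cl_rels_ab k q a b -> p \in rels.
Proof.
move=> hp; apply/flattenP; exists (cl_rels_ab k q a b) => //.
by apply/allpairsP; exists (a, b); rewrite !mem_enum.
Qed.

Local Arguments ncscale : simpl never.
Local Arguments ncmul : simpl never.
Local Arguments ncpow : simpl never.
Local Arguments ncadd : simpl never.
Local Arguments ncsub : simpl never.
Let pairingE := (pairing_sub, pairing_add, pairing_scale, pairing_mul,
  pairing_gen, pairing_one, pairing_pow).

(** The bound 8 covers the relations imposed for every pair of sites; the ninth, present only for
    [a != b], is treated in [psi_psis_anticomm]. *)
Lemma idl_cl_rels a b i : (i < 8)%N ->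
  idl rels (fun phi => pairing phi (nth (ncone K n) (cl_rels_ab k q a b) i)).
Proof.
move=> hi; apply/idl_rel/mem_cl_rels/mem_nth.
by rewrite size_cat; apply: (leq_trans hi); apply: leq_addr.
Qed.

Lemma omega_comm a b : monred [:: O a; O b] 1 [:: O b; O a].
Proof.
by apply: (idl_ext (@idl_cl_rels a b 0 isT)) => phi /=; rewrite !pairingE mul1r.
Qed.

Lemma omegaK a : monred [:: O a; H a] 1 [::].
Proof.
by apply: (idl_ext (@idl_cl_rels a a 1 isT)) => phi /=; rewrite !pairingE mul1r.
Qed.

Lemma omega_psi a b : monred [:: O a; P b] (q ^+ (a == b)) [:: P b; O a].
Proof.
by apply: (idl_ext (@idl_cl_rels a b 2 isT)) => phi /=; rewrite !pairingE.
Qed.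

Lemma omega_psis a b : monred [:: O a; Q b] (q ^+ (a == b))^-1 [:: Q b; O a].
Proof.
by apply: (idl_ext (@idl_cl_rels a b 3 isT)) => phi /=; rewrite !pairingE.
Qed.

Lemma psi_anticomm a b : monred [:: P a; P b] (-1) [:: P b; P a].
Proof.
apply: (idl_ext (@idl_cl_rels a b 4 isT)) => phi /=.
by rewrite !pairingE mulN1r opprK.
Qed.

Lemma psis_anticomm a b : monred [:: Q a; Q b] (-1) [:: Q b; Q a].
Proof.
apply: (idl_ext (@idl_cl_rels a b 5 isT)) => phi /=.
by rewrite !pairingE mulN1r opprK.
Qed.

Lemma omegaV_pow a :
  birel (nseq k (H a)) 1 [:: P a; Q a] (q ^+ k) [:: Q a; P a].
Proof.
apply: (idl_ext (idlZ (-1) (@idl_cl_rels a a 6 isT))) => phi /=.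
by rewrite !pairingE; ring.
Qed.

Lemma omega_pow a :
  birel (nseq k (O a)) 1 [:: P a; Q a] (q ^- k) [:: Q a; P a].
Proof.
apply: (idl_ext (idlZ (-1) (@idl_cl_rels a a 7 isT))) => phi /=.
by rewrite !pairingE; ring.
Qed.

Lemma psi_psis_anticomm a b :
  a != b -> monred [:: P a; Q b] (-1) [:: Q b; P a].
Proof.
move=> ab; have /idl_rel h : ncadd (ncmul (psi K a) (psis K b))
    (ncmul (psis K b) (psi K a)) \in rels.
  by apply: (@mem_cl_rels a b); rewrite mem_cat ab mem_head orbT.
by apply: (idl_ext h) => phi; rewrite !pairingE mulN1r opprK.
Qed.

Let qk_neq0 : q ^+ k != 0. Proof. exact: expf_neq0. Qed.

(** From [g g = - g g] follows [2 g g = 0]; this is where characteristic different from 2 enters. *)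
Lemma anticomm_sqr g w : monred [:: g; g] (-1) [:: g; g] -> monred [:: g; g] 0 w.
Proof.
move=> h; apply: (idl_ext (idlZ 2%:R^-1 h)) => phi; field; exact: two_neq0.
Qed.

Lemma psi_sqr a w : monred [:: P a; P a] 0 w.
Proof. exact/anticomm_sqr/psi_anticomm. Qed.

Lemma psis_sqr a w : monred [:: Q a; Q a] 0 w.
Proof. exact/anticomm_sqr/psis_anticomm. Qed.

(** Multiplying a mixed relation on the left by [psi] kills the summand that begins with [psi]. The
    next three lemmas use the same device. *)
Lemma psi_omega_pow a :
  monred (P a :: nseq k (O a)) (q ^- k) [:: P a; Q a; P a].
Proof.
have := birel_ctx [:: P a] [::] (omega_pow a); rewrite cats0 => h.
exact: (birel0l h (monred_ctxr [:: Q a] (psi_sqr a [::]))).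
Qed.

Lemma psis_omega_pow a : monred (Q a :: nseq k (O a)) 1 [:: Q a; P a; Q a].
Proof.
have := birel_ctx [:: Q a] [::] (omega_pow a); rewrite cats0 => h.
exact: (birel0r h (monred_ctxr [:: P a] (psis_sqr a [::]))).
Qed.

Lemma psi_omegaV_pow a :
  monred (P a :: nseq k (H a)) (q ^+ k) [:: P a; Q a; P a].
Proof.
have := birel_ctx [:: P a] [::] (omegaV_pow a); rewrite cats0 => h.
exact: (birel0l h (monred_ctxr [:: Q a] (psi_sqr a [::]))).
Qed.

Lemma psis_omegaV_pow a : monred (Q a :: nseq k (H a)) 1 [:: Q a; P a; Q a].
Proof.
have := birel_ctx [:: Q a] [::] (omegaV_pow a); rewrite cats0 => h.
exact: (birel0r h (monred_ctxr [:: P a] (psis_sqr a [::]))).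
Qed.

Lemma omega_powK a m : monred (nseq m (O a) ++ nseq m (H a)) 1 [::].
Proof.
elim: m => [|m IHm]; first exact: monred_refl.
have -> : nseq m.+1 (O a) ++ nseq m.+1 (H a)
    = nseq m (O a) ++ [:: O a; H a] ++ nseq m (H a).
  by rewrite -{1}addn1 nseqD -catA.
by rewrite -(mul1r 1); apply: monred_trans (monred_ctx _ _ (omegaK a)) IHm.
Qed.

Lemma omegaV_omega_pow_split a :
  birel (nseq k (H a) ++ nseq k (O a)) 1 ([:: P a; Q a] ++ nseq k (O a))
    (q ^+ k) ([:: Q a; P a] ++ nseq k (O a)).
Proof. exact: (birel_ctx [::] (nseq k (O a)) (omegaV_pow a)). Qed.

(* Only [omega * omegaV = 1] is imposed; the opposite order follows since
   [omega ^ k] and [omegaV ^ k] both lie in the commutative span of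
   [psi * psis] and [psis * psi]. *)
Lemma omegaV_powK a : monred (nseq k (H a) ++ nseq k (O a)) 1 [::].
Proof.
have h1 := birel_monred (omegaV_omega_pow_split a)
  (monred_ctxl [:: P a] (psis_omega_pow a))
  (monred_ctxl [:: Q a] (psi_omega_pow a)).
have h2 := birel_monred (birel_ctx [::] (nseq k (H a)) (omega_pow a))
  (monred_ctxl [:: P a] (psis_omegaV_pow a))
  (monred_ctxl [:: Q a] (psi_omegaV_pow a)).
have h3 := omega_powK a k.
apply: (idl_ext (idlD h1 (idlD (idlZ (-1) h2) h3))) => phi /=; field.
exact: qk_neq0.
Qed.

(** The empty word is not a basis word. Expanding the first factor of [omega ^ -k * omega ^ k = 1]
    writes it through words of basis shape at site [a]. *)
Lemma one_split a : birel [::]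
  1 ([:: P a; Q a] ++ nseq k (O a)) (q ^+ k) ([:: Q a; P a] ++ nseq k (O a)).
Proof.
apply: (idl_ext (idlD (idlZ (-1) (omegaV_powK a))
  (omegaV_omega_pow_split a))) => phi; ring.
Qed.

(** Write the inverse of [omega] as [omega ^ -k * omega ^ (k - 1)] and expand the first factor; this
    eliminates the letter [t3] from words. *)
Lemma omegaV_split a : birel [:: H a]
  1 ([:: P a; Q a] ++ nseq k.-1 (O a)) (q ^+ k) ([:: Q a; P a] ++ nseq k.-1 (O a)).
Proof.
have h : monred (nseq k (H a) ++ nseq k.-1 (O a)) 1 [:: H a].
  (* The word [omegaV ^ k * omega ^ k * omegaV] is reduced in two ways, cancelling either the first
     two factors or the final pair [omega * omegaV]. *)
  have h1 := monred_ctxr [:: H a] (omegaV_powK a).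
  have h2 := monred_ctxl (nseq k (H a) ++ nseq k.-1 (O a)) (omegaK a).
  have e : (nseq k (H a) ++ nseq k.-1 (O a)) ++ [:: O a; H a]
     = (nseq k (H a) ++ nseq k (O a)) ++ [:: H a].
    have -> : nseq k (O a) = nseq k.-1 (O a) ++ [:: O a].
      by rewrite -{1}(prednK k_gt0) -addn1 nseqD.
    by rewrite -!catA.
  rewrite e cats0 in h2.
  by apply: (idl_ext (idlD h1 (idlZ (-1) h2))) => phi; ring.
apply: (idl_ext (idlD (idlZ (-1) h)
  (birel_ctx [::] (nseq k.-1 (O a)) (omegaV_pow a)))) => phi /=; ring.
Qed.

Lemma psi_psis_psi a : monred [:: P a; Q a; P a] (q ^+ k) (P a :: nseq k (O a)).
Proof.
rewrite -[q ^+ k]invrK; apply: monred_sym; first by rewrite invr_neq0.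
exact: psi_omega_pow.
Qed.

Lemma psis_psi_psis a : monred [:: Q a; P a; Q a] 1 (Q a :: nseq k (O a)).
Proof.
by rewrite -[1]invr1; apply: monred_sym (psis_omega_pow a); rewrite oner_neq0.
Qed.

(** Both [psi omega^k] and [psi omega^-k] are multiples of [psi psis psi], hence proportional;
    multiplying by [omega^k] gives the claim. This makes exponents of [omega] matter only modulo
    [2 * k]. *)
Lemma psi_omega_pow2 a :
  monred (P a :: nseq (2 * k) (O a)) (q ^- k * q ^- k) [:: P a].
Proof.
have h1 := monred_ctxr (nseq k (O a)) (psi_omega_pow a).
have h2 := monred_ctxr (nseq k (O a)) (psi_omegaV_pow a).
have h3 := monred_ctxl [:: P a] (omegaV_powK a).
rewrite mul2n -addnn nseqD.
apply: (idl_ext (idlD h1 (idlD (idlZ (- (q ^- k * q ^- k)) h2)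
  (idlZ (q ^- k * q ^- k) h3)))) => phi /=; field.
exact: qk_neq0.
Qed.

Lemma psis_omega_pow2 a : monred (Q a :: nseq (2 * k) (O a)) 1 [:: Q a].
Proof.
have h1 := monred_ctxr (nseq k (O a)) (psis_omega_pow a).
have h2 := monred_ctxr (nseq k (O a)) (psis_omegaV_pow a).
have h3 := monred_ctxl [:: Q a] (omegaV_powK a).
rewrite mul2n -addnn nseqD.
apply: (idl_ext (idlD h1 (idlD (idlZ (-1) h2) h3))) => phi /=; ring.
Qed.

End Relations.

(** * The words that will form the basis *)

Section BasisWords.
Variables (n k : nat).

(* The component at one site of a basis word, as (target, source, power of
   omega): [false] is the range of [psi], [true] that of [psis]. *)
Definition site : finType := (bool * bool * 'Z_(2 * k))%type.

Definition fermi (a : 'I_n) (x : bool * bool) : word n :=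
  match x with
  | (false, true) => [:: (a, t0)]
  | (true, false) => [:: (a, t1)]
  | (false, false) => [:: (a, t0); (a, t1)]
  | (true, true) => [:: (a, t1); (a, t0)]
  end.

Definition block (a : 'I_n) (x : site) : word n :=
  fermi a x.1 ++ nseq x.2 (a, t2).

Definition mword (s : seq 'I_n) (f : 'I_n -> site) : word n :=
  flatten [seq block a (f a) | a <- s].

Definition basis_word (f : {ffun 'I_n -> site}) : word n := mword (enum 'I_n) f.

End BasisWords.

(** * The basis words span *)

Section Spanning.
Variables (K : fieldType) (n k : nat) (q : K).
Hypotheses (two_neq0 : (2%:R : K) != 0) (q_neq0 : q != 0) (k_gt0 : (0 < k)%N).

Local Notation P a := ((a, t0) : gen n).
Local Notation Q a := ((a, t1) : gen n).
Local Notation O a := ((a, t2) : gen n).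
Local Notation rels := (cl_rels n k q).
Local Notation site := (site k).
Implicit Types (a b : 'I_n) (g h : gen n) (w : word n) (s : seq 'I_n).

(** Spanning does not depend on the scalars, so they are forgotten; a zero scalar is allowed. *)
Definition wred w w' := exists c, monred rels w c w'.

Lemma wred_refl w : wred w w.
Proof. exists 1; exact: monred_refl. Qed.

Lemma wred_trans w2 w1 w3 : wred w1 w2 -> wred w2 w3 -> wred w1 w3.
Proof. by move=> [c hc] [d hd]; exists (c * d); apply: monred_trans hc hd. Qed.

Lemma wred_ctxl u w w' : wred w w' -> wred (u ++ w) (u ++ w').
Proof. by move=> [c hc]; exists c; apply: monred_ctxl. Qed.

Lemma wred_ctxr v w w' : wred w w' -> wred (w ++ v) (w' ++ v).
Proof. by move=> [c hc]; exists c; apply: monred_ctxr. Qed.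

Lemma wred_pass g w :
  {in w, forall h, wred [:: g; h] [:: h; g]} -> wred (g :: w) (w ++ [:: g]).
Proof.
elim: w => [|h w IHw] hw; first exact: wred_refl.
apply: (@wred_trans ([:: h] ++ (g :: w))).
  by apply: (wred_ctxr w (hw h _)); apply: mem_head.
by apply/(@wred_ctxl [:: h])/IHw => h' wh'; apply: hw; rewrite inE wh' orbT.
Qed.

Lemma ord4_neq3 (t : 'I_4) : t != t3 -> [\/ t = t0, t = t1 | t = t2].
Proof.
case: t => [[|[|[|[|//]]]] ht] //= _;
  by [apply: Or31; apply: val_inj | apply: Or32; apply: val_inj
     | apply: Or33; apply: val_inj].
Qed.

Lemma wred_omega a h : h.2 != t3 -> wred [:: O a; h] [:: h; O a].
Proof.
case: h => b t /ord4_neq3[] /= ->; eexists.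
- exact: omega_psi.
- exact: omega_psis.
- exact: omega_comm.
Qed.

Lemma wred_sites a b t u : a != b -> t != t3 -> u != t3 ->
  wred [:: (a, t); (b, u)] [:: (b, u); (a, t)].
Proof.
move=> ab /ord4_neq3[] -> hu; last exact: (@wred_omega a (b, u)).
- have ba : (b == a) = false by rewrite eq_sym; apply: negbTE.
  case/ord4_neq3: hu => ->; eexists.
  + exact: psi_anticomm.
  + exact: psi_psis_anticomm.
  + have := omega_psi k q b a; rewrite ba expr0.
    exact: (monred_sym (oner_neq0 K)).
- have ba : (b == a) = false by rewrite eq_sym; apply: negbTE.
  case/ord4_neq3: hu => ->; eexists.
  + have := @psi_psis_anticomm K n k q b a; rewrite ba => /(_ isT).
    by apply: monred_sym; rewrite oppr_eq0 oner_neq0.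
  + exact: psis_anticomm.
  + have := omega_psis k q b a; rewrite ba expr0 invr1.
    exact: (monred_sym (oner_neq0 K)).
Qed.

Lemma wred_fermi_pow2 a x :
  wred (fermi a x ++ nseq (2 * k) (O a)) (fermi a x).
Proof.
case: x => [[] []] /=; eexists.
- exact: (@monred_ctxl _ _ _ [:: Q a] _ _ _ (psi_omega_pow2 _ _ _ _)).
- exact: psis_omega_pow2.
- exact: psi_omega_pow2.
- exact: (@monred_ctxl _ _ _ [:: P a] _ _ _ (psis_omega_pow2 _ _ _ _)).
Qed.

Lemma wred_block_mod a x m :
  wred (fermi a x ++ nseq m (O a)) (block a ((x, m%:R) : site)).
Proof.
rewrite /block /= val_Zp_nat ?(leq_pmulr 2) //.
rewrite {1}(divn_eq m (2 * k)); set r := (m %% _)%N.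
elim: (m %/ _)%N => [|j IHj]; first exact: wred_refl.
rewrite mulSn -addnA nseqD catA.
exact: wred_trans (wred_ctxr _ (wred_fermi_pow2 a x)) IHj.
Qed.

Lemma wred_block a t (x : site) : t != t3 ->
  exists y : site, wred ((a, t) :: block a x) (block a y).
Proof.
have mod0 v m z : wred v (fermi a z ++ nseq m (O a)) ->
    exists y : site, wred v (block a y).
  by move=> h; exists (z, m%:R); apply: wred_trans h (wred_block_mod _ _ _).
(* With scalar zero any target will do, so [x] itself is taken. *)
have vanish v w : monred rels v 0 [::] -> exists y : site, wred (v ++ w) (block a y).
  move=> h; exists x; exists 0; apply: (idl_ext (monred_ctxr w h)) => phi.
  by rewrite !mul0r.
case: x => x i; rewrite /block /=.
case/ord4_neq3 => ->.
- case: x => [[] []] /=.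
  (* Here [psi psis psi] becomes a multiple of [psi omega^k], whence the exponent [k + i]. *)
  + apply: (mod0 _ (k + i)%N (false, true)).
    rewrite nseqD catA; eexists.
    exact: (monred_ctxr (nseq i (O a)) (psi_psis_psi k two_neq0 q_neq0 a)).
  + by apply: (mod0 _ i (false, false)); apply: wred_refl.
  + exact: (vanish [:: P a; P a] _ (psi_sqr k q two_neq0 a [::])).
  + exact: (vanish [:: P a; P a] _ (psi_sqr k q two_neq0 a [::])).
- case: x => [[] []] /=.
  + exact: (vanish [:: Q a; Q a] _ (psis_sqr k q two_neq0 a [::])).
  + exact: (vanish [:: Q a; Q a] _ (psis_sqr k q two_neq0 a [::])).
  + by apply: (mod0 _ i (true, true)); apply: wred_refl.
  + apply: (mod0 _ (k + i)%N (true, false)).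
    rewrite nseqD catA; eexists.
    exact: (monred_ctxr (nseq i (O a)) (psis_psi_psis k q two_neq0 a)).
(* [omega] passes the fermionic letters up to a scalar and joins the power at the right end. *)
- apply: (mod0 _ i.+1 x); rewrite -[i.+1]add1n nseqD catA.
  apply: (@wred_ctxr _ (O a :: _)); apply: wred_pass => g.
  by case: x => [[] []] /=; rewrite !inE => hg; apply: wred_omega;
    move: hg; do ?[case/orP]; move/eqP->.
Qed.

Lemma eq_mword s (f f' : 'I_n -> site) : {in s, f =1 f'} -> mword s f = mword s f'.
Proof.
move=> e; congr flatten; apply/eq_in_map => a sa; congr (block a _); exact: e.
Qed.

Lemma mem_block a (x : site) g : g \in block a x -> g.1 = a /\ g.2 != t3.
Proof.
rewrite mem_cat mem_nseq => /orP[|/andP[_ /eqP->] //].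
by case: x => [[[] []] i]; rewrite !inE; do ?[case/orP]; move/eqP->.
Qed.

Lemma mword_update s1 a s2 (f : 'I_n -> site) y : uniq (s1 ++ a :: s2) ->
  mword (s1 ++ a :: s2) (finfun [eta f with a |-> y]) =
  mword s1 f ++ block a y ++ mword s2 f.
Proof.
rewrite cat_uniq /= negb_or => /and4P[_ /andP[as1 _] as2 _].
rewrite /mword map_cat flatten_cat /= ffunE /= eqxx; congr (_ ++ _ ++ _).
  by apply: eq_mword => b sb; rewrite ffunE /= ifN //; apply: contraNneq as1 => <-.
by apply: eq_mword => b sb; rewrite ffunE /= ifN //; apply: contraNneq as2 => <-.
Qed.

(** The letter is carried past the blocks of the sites preceding [a], from which it differs in site,
    and then absorbed into the block at [a]. *)
Lemma wred_basis a t (f : {ffun 'I_n -> site}) : t != t3 ->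
  exists f' : {ffun 'I_n -> site}, wred ((a, t) :: basis_word f) (basis_word f').
Proof.
move=> ht; have [y hy] := wred_block a (f a) ht.
exists (finfun [eta f with a |-> y]); rewrite /basis_word.
have := enum_uniq 'I_n; have := mem_enum 'I_n a; rewrite inE.
case/splitPr=> s1 s2 us; rewrite mword_update //.
rewrite /mword map_cat flatten_cat /= -/(mword s1 f) -/(mword s2 f).
apply: (@wred_trans (mword s1 f ++ ((a, t) :: block a (f a)) ++ mword s2 f)).
  have pass : wred ((a, t) :: mword s1 f) (mword s1 f ++ [:: (a, t)]).
    apply: wred_pass => -[b u] /flatten_mapP[b' sb' /mem_block[/= -> hu]].
    apply: wred_sites => //; move: us.
    rewrite cat_uniq /= negb_or => /and4P[_ /andP[as1 _] _ _].
    by apply: contraNneq as1 => ->.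
  by have := wred_ctxr (block a (f a) ++ mword s2 f) pass; rewrite -catA.
exact/wred_ctxl/wred_ctxr.
Qed.

Local Notation spanned :=
  (spanned rels (@basis_word n k : {ffun 'I_n -> site} -> word n)).

Lemma spanned_cons a t w : t != t3 ->
  spanned (fun phi => phi w) -> spanned (fun phi => phi ((a, t) :: w)).
Proof.
move=> ht; apply: spanned_left => f.
have [f' [c h]] := wred_basis a f ht.
exact: spanned_monred h (spanned_basis _ _ _).
Qed.

(** Insert [one_split] at the sites one after another. The induction is on the list [s2] of sites
    still untreated; each step replaces a partial word by two partial words with one more block. *)
Lemma spanned_nil : spanned (fun phi => phi [::]).
Proof.
suff partial s1 s2 (f : 'I_n -> site) : s1 ++ s2 = enum 'I_n ->
    spanned (fun phi => phi (mword s1 f)).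
  by apply: (@partial [::] (enum 'I_n) (fun=> (false, false, 0))).
elim: s2 s1 f => [|a s2 IHs] s1 f es.
  rewrite cats0 in es.
  apply: (spanned_ext (spanned_basis rels _ (finfun f))) => phi.
  by rewrite /basis_word -es; congr phi; apply: eq_mword => b _; rewrite ffunE.
have us : uniq (s1 ++ a :: [::]).
  have := enum_uniq 'I_n; rewrite -es -cat1s catA cat_uniq => /and3P[] //.
have term (x : bool * bool) :
    spanned (fun phi => phi (mword s1 f ++ fermi a x ++ nseq k (O a))).
  have := @mword_update s1 a [::] f (x, k%:R) us; rewrite cats0 => e.
  have [c hc] := wred_ctxl (mword s1 f) (wred_block_mod a x k).
  apply: (spanned_monred hc); rewrite -e.
  by apply: IHs; rewrite -es -catA.
have h := birel_ctx (mword s1 f) [::] (one_split k two_neq0 q_neq0 a).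
rewrite !cats0 in h; apply: (spanned_birel h).
  exact: (term (false, false)).
exact: (term (true, true)).
Qed.

Lemma spanned_word w : spanned (fun phi => phi w).
Proof.
elim: w => [|[a t] w IHw]; first exact: spanned_nil.
have [-> | ht] := eqVneq t t3; last exact: spanned_cons.
(* [omegaV_split] trades the letter for words with [k.-1] copies of [omega] and no [t3]. *)
have hO : spanned (fun phi => phi (nseq k.-1 (O a) ++ w)).
  by elim: (k.-1) => // m IHm; apply: spanned_cons.
have h := birel_ctx [::] w (omegaV_split two_neq0 q_neq0 k_gt0 a).
by apply: (spanned_birel h); do 2!apply: spanned_cons => //.
Qed.

End Spanning.

(** * The Jordan-Wigner representation and independence *)

Section Representation.
Variables (K : fieldType) (n k : nat) (q : K).
Hypotheses (q_neq0 : q != 0) (k_gt0 : (0 < k)%N).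

Local Notation O a := ((a, t2) : gen n).
Local Notation H a := ((a, t3) : gen n).
Local Notation site := (site k).
Local Notation level := (bool * 'Z_(2 * k))%type.
Local Notation state := {ffun 'I_n -> bool * 'Z_(2 * k)}.
Implicit Types (a b : 'I_n) (t u : 'I_4) (x y : level) (S : state)
  (h : state -> K) (w : word n).

(** One-site action: [(false, j)] and [(true, j)] stand for the vectors (e, j) and (f, j), [lcoef]
    is the scalar and [lmove] the target. Where the scalar vanishes the target is a junk value. *)
Definition lcoef t x : K :=
  match val t with
  | 0 => x.1%:R
  | 1 => (~~ x.1)%:R
  | 2 => if x.1 then q^-1 else 1
  | _ => if x.1 then q else 1
  end.

Definition lmove t x : level :=
  match val t with
  | 0 => (false, x.2 + k%:R)
  | 1 => (true, x.2)
  | 2 => (x.1, x.2 + 1)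
  | _ => (x.1, x.2 - 1)
  end.

Definition fermionic t := (val t < 2)%N.

Definition set_level S a x : state := finfun [eta S with a |-> x].

(* Jordan-Wigner sign *)
Definition jw a S : K := \prod_(b < n | (b < a)%N) (-1) ^+ (S b).1.

Definition jwsign t a S : K := if fermionic t then jw a S else 1.

(* The representation sends the basis vector [S] to a multiple of a basis
   vector; it is recorded through its transpose, acting on functions [h] of
   the state, so that words are applied from left to right. *)
Definition act (g : gen n) h S : K :=
  lcoef g.2 (S g.1) * jwsign g.2 g.1 S *
  h (set_level S g.1 (lmove g.2 (S g.1))).

Definition ev w h : state -> K := foldl (fun h' g => act g h') h w.

Lemma ev_cat w w' h : ev (w ++ w') h = ev w' (ev w h).
Proof. exact: foldl_cat. Qed.

Lemma set_levelE S a x b : set_level S a x b = if b == a then x else S b.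
Proof. by rewrite ffunE. Qed.

Lemma set_level_id S a : set_level S a (S a) = S.
Proof. by apply/ffunP => b; rewrite set_levelE; case: eqP => // ->. Qed.

Lemma set_set_level S a x y : set_level (set_level S a x) a y = set_level S a y.
Proof. by apply/ffunP => b; rewrite !set_levelE; case: eqP. Qed.

Lemma set_level_comm S a b x y : a != b ->
  set_level (set_level S a x) b y = set_level (set_level S b y) a x.
Proof.
move=> ab; apply/ffunP => c; rewrite !set_levelE.
by case: (eqVneq c b) => [->|//]; rewrite eq_sym (negPf ab).
Qed.

Lemma jw_sqr a S : jw a S * jw a S = 1.
Proof.
by rewrite -big_split /=; apply: big1 => b _; rewrite -expr2 sqrr_sign.
Qed.

Lemma jw_neq0 a S : jw a S != 0.
Proof.
by apply/eqP => e; have /eqP := jw_sqr a S; rewrite e mul0r eq_sym oner_eq0.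
Qed.

Lemma jw_set_ge a b S y : (a <= b)%N -> jw a (set_level S b y) = jw a S.
Proof.
move=> ab; apply: eq_bigr => c ca; rewrite set_levelE ifN //.
by apply: contraTneq ca => ->; rewrite -leqNgt.
Qed.

Lemma jw_set_lt a b S y : (b < a)%N ->
  jw a (set_level S b y) = (-1) ^+ ((S b).1 + y.1) * jw a S.
Proof.
move=> ba; rewrite /jw (bigD1 b) //= [in RHS](bigD1 b) //= set_levelE eqxx.
rewrite exprD mulrCA !mulrA -expr2 sqrr_sign mul1r; congr (_ * _).
by apply: eq_bigr => c /andP[_ cb]; rewrite set_levelE (negPf cb).
Qed.

(** A letter that does not annihilate [x] flips its boolean exactly when it is fermionic. The factor
    [lcoef] stays on both sides because this fails for annihilated levels. *)
Lemma lcoef_flip t x :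
  lcoef t x * (-1) ^+ (x.1 + (lmove t x).1) = lcoef t x * (-1) ^+ fermionic t.
Proof.
rewrite -[in LHS]signr_odd.
by case: t x => [[|[|[|[|//]]]] ht] [[] j]; rewrite /lcoef /lmove /= ?mul0r.
Qed.

Lemma act_act_same a t u h S :
  act (a, t) (act (a, u) h) S =
  lcoef t (S a) * lcoef u (lmove t (S a)) * (jwsign t a S * jwsign u a S) *
  h (set_level S a (lmove u (lmove t (S a)))).
Proof.
rewrite /act /= set_set_level set_levelE eqxx.
have -> y : jwsign u a (set_level S a y) = jwsign u a S.
  by rewrite /jwsign; case: ifP => // _; rewrite jw_set_ge.
ring.
Qed.

Lemma jwsign_set a b t u S : (b < a)%N ->
  lcoef u (S b) * jwsign t a (set_level S b (lmove u (S b))) =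
  lcoef u (S b) * (-1) ^+ (fermionic t && fermionic u) * jwsign t a S.
Proof.
rewrite /jwsign => ba; case: (fermionic t); last by rewrite expr0 !mulr1.
by rewrite jw_set_lt // mulrA lcoef_flip.
Qed.

Lemma jwsign_set_ge a b t S y : (a <= b)%N ->
  jwsign t a (set_level S b y) = jwsign t a S.
Proof. by move=> ab; rewrite /jwsign; case: ifP => // _; rewrite jw_set_ge. Qed.

(** Only the sign at the later site [a] sees the move at [b], so exchanging the letters costs one
    sign, and only if both are fermionic. *)
Lemma act_act_lt a b t u h S : (b < a)%N ->
  act (a, t) (act (b, u) h) S =
  (-1) ^+ (fermionic t && fermionic u) * act (b, u) (act (a, t) h) S.
Proof.
move=> ba; have ab : a != b by rewrite -val_eqE neq_ltn /= ba orbT.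
rewrite /act /= !set_levelE [b == a]eq_sym (negPf ab).
rewrite jwsign_set_ge 1?ltnW // set_level_comm //.
have e := jwsign_set t u S ba.
set X := h _; set A := lcoef t _ in e *; set B := lcoef u _ in e *.
set sg := (-1) ^+ _ in e *; set J := jwsign t a S in e *.
set J' := jwsign t a _ in e *; set I := jwsign u b S.
have -> : sg * (B * I * (A * J' * X)) = sg * A * I * X * (B * J') by ring.
rewrite e; have : sg * sg = 1 by rewrite -expr2 sqrr_sign.
move=> sg2; transitivity (A * J * (B * I * X) * (sg * sg)); last by ring.
by rewrite sg2 mulr1.
Qed.

Lemma act_act_neq a b t u h S : a != b ->
  act (a, t) (act (b, u) h) S =
  (-1) ^+ (fermionic t && fermionic u) * act (b, u) (act (a, t) h) S.
Proof.
rewrite -val_eqE neq_ltn => /orP[|] lt_ab; last exact: act_act_lt.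
by rewrite (act_act_lt u t) // andbC mulrA -expr2 sqrr_sign mul1r.
Qed.

Lemma ev_omega_pow a m h S : ev (nseq m (O a)) h S =
  (if (S a).1 then q ^- m else 1) *
  h (set_level S a ((S a).1, (S a).2 + m%:R)).
Proof.
elim: m S h => [|m IHm] S h.
  rewrite /= expr0 invr1 addr0 -surjective_pairing set_level_id.
  by case: ifP; rewrite mul1r.
rewrite -addn1 nseqD ev_cat /= /act /= /jwsign /= IHm set_levelE eqxx.
rewrite set_set_level /lcoef /lmove /= addn1 mulrS addrA exprS invfM.
by case: ifP => _; ring.
Qed.

Lemma ev_omegaV_pow a m h S : ev (nseq m (H a)) h S =
  (if (S a).1 then q ^+ m else 1) *
  h (set_level S a ((S a).1, (S a).2 - m%:R)).
Proof.
elim: m S h => [|m IHm] S h.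
  rewrite /= expr0 subr0 -surjective_pairing set_level_id.
  by case: ifP; rewrite mul1r.
rewrite -addn1 nseqD ev_cat /= /act /= /jwsign /= IHm set_levelE eqxx.
rewrite set_set_level /lcoef /lmove /= addn1 mulrS opprD addrA exprS.
by case: ifP => _; ring.
Qed.

(** Reconciles the two mixed relations: [omega^-k] lowers the level by [k], while [psi psis] and
    [psis psi] raise it by [k]. *)
Lemma oppr_half : - (k%:R : 'Z_(2 * k)) = k%:R.
Proof.
apply/eqP; rewrite eq_sym -subr_eq0 opprK -natrD addnn -mul2n.
by rewrite pchar_Zp // leq_pmulr.
Qed.

Local Arguments ncscale : simpl never.
Local Arguments ncmul : simpl never.
Local Arguments ncpow : simpl never.
Local Arguments ncadd : simpl never.
Local Arguments ncsub : simpl never.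

Let pairingE := (pairing_sub, pairing_add, pairing_scale, pairing_mul,
  pairing_gen, pairing_one, pairing_pow).

Lemma ev_cl_rels p h S :
  p \in cl_rels n k q -> pairing (fun w => ev w h S) p = 0.
Proof.
have q0 := q_neq0; have qk0 : q ^+ k != 0 by apply: expf_neq0.
have two a t u : ev ([:: (a, t)] ++ [:: (a, u)]) h S =
  lcoef u (S a) * lcoef t (lmove u (S a)) * (jwsign u a S * jwsign t a S) *
  h (set_level S a (lmove t (lmove u (S a)))) by apply: act_act_same.
have twoN a b t u : a != b -> ev ([:: (a, t)] ++ [:: (b, u)]) h S =
    (-1) ^+ (fermionic t && fermionic u) * ev ([:: (b, u)] ++ [:: (a, t)]) h S.
  by move=> ab; rewrite /= act_act_neq 1?eq_sym // andbC.
case/flattenP=> l /allpairsP[[a b] [_ _ ->]] /=; rewrite /cl_rels_ab mem_cat.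
case/orP; last first.
  case: ifP => // ab; rewrite inE => /eqP->; rewrite !pairingE twoN //=.
  by ring.
(* Distinct sites are settled by the sign rule [twoN], equal sites by computing on the level, split
   on its boolean where needed. *)
rewrite !inE => /or4P[/eqP->|/eqP->|/eqP->|/or4P[/eqP->|/eqP->|/eqP->|]].
- rewrite !pairingE; have [<-|ab] := eqVneq a b; first by rewrite subrr.
  by rewrite twoN //= mul1r subrr.
- rewrite !pairingE two /jwsign /lcoef /lmove /= subrK -surjective_pairing.
  rewrite set_level_id; case: ifP => _ /=; last by ring.
  by field.
- rewrite !pairingE; have [<-|ab] := eqVneq a b; last first.
    by rewrite twoN //=; ring.
  rewrite !two /jwsign /lcoef /lmove /= [_ + 1 + _]addrAC.
  by case: (S a).1 => /=; [field | ring].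
- rewrite !pairingE; have [<-|ab] := eqVneq a b; last first.
    by rewrite twoN //= invr1; ring.
  by rewrite !two /jwsign /lcoef /lmove /=; case: (S a).1 => /=; ring.
- rewrite !pairingE; have [<-|ab] := eqVneq a b; last first.
    by rewrite twoN //=; ring.
  by rewrite !two /lcoef /lmove /=; ring.
- rewrite !pairingE; have [<-|ab] := eqVneq a b; last first.
    by rewrite twoN //=; ring.
  by rewrite !two /lcoef /lmove /=; ring.
case/orP=> /eqP->; rewrite !pairingE !two /jwsign /= jw_sqr.
- rewrite ev_omegaV_pow /lcoef /lmove /= oppr_half.
  by case: (S a).1 => /=; ring.
- rewrite ev_omega_pow /lcoef /lmove /=.
  by case: (S a).1 => /=; ring.
Qed.

(** In [u r v] with [r] a relation, the right context [v] acts first; it merely replaces [S] by a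
    multiple of one state, at which [r] can be evaluated. *)
Lemma ev_monomial w S : exists c S', forall h, ev w h S = c * h S'.
Proof.
elim/last_ind: w S => [|w g IHw] S.
  by exists 1, S => h; rewrite mul1r.
have [c [S' e]] := IHw (set_level S g.1 (lmove g.2 (S g.1))).
exists (lcoef g.2 (S g.1) * jwsign g.2 g.1 S * c), S' => h.
by rewrite -cats1 ev_cat /= /act e mulrA.
Qed.

Lemma ev_idl F h S : idl (cl_rels n k q) F -> F (fun w => ev w h S) = 0.
Proof.
move=> [s [hs ->]]; rewrite big_seq; apply: big1 => t ts.
have [c [S' e]] := ev_monomial t.2 S.
have -> : pairing (fun w => ev (t.1.1.2 ++ w ++ t.2) h S) t.1.2 =
    c * pairing (fun w => ev w (ev t.1.1.2 h) S') t.1.2.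
  rewrite /pairing mulr_sumr; apply: eq_bigr => z _.
  by rewrite !ev_cat e mulrCA.
by rewrite ev_cl_rels ?mulr0 //; apply: (allP hs).
Qed.

(** Each occurrence of [psi] adds [k]; [psis] alone is the only fermionic word without one. *)
Definition shift (z : bool * bool) : 'Z_(2 * k) :=
  if z is (true, false) then 0 else k%:R.

Definition site_move (z : site) x : level :=
  (z.1.1, x.2 + z.2 + shift z.1).

Lemma ev_block a (z : site) S : exists d,
  (d != 0) = ((S a).1 == z.1.2) /\
  forall h, ev (block a z) h S = d * h (set_level S a (site_move z (S a))).
Proof.
(* The power of [omega] ends the block and so acts first; [c] is its scalar, leaving the fermionic
   word to be evaluated at the displaced level. *)
pose c := if (S a).1 then q ^- z.2 else 1.
have c0 : c != 0 by rewrite /c; case: ifP; rewrite ?oner_neq0 ?invr_neq0 ?expf_neq0.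
have sg y : jw a (set_level S a y) = jw a S by apply: jw_set_ge.
have j0 := jw_neq0 a S.
suff [d [hd e]] : exists d, (d != 0) = ((S a).1 == z.1.2) /\ forall h,
    ev (fermi a z.1) h (set_level S a ((S a).1, (S a).2 + z.2)) =
    d * h (set_level S a (site_move z (S a))).
  exists (c * d); split; first by rewrite mulf_eq0 negb_or c0 hd.
  by move=> h; rewrite ev_cat ev_omega_pow natr_Zp e mulrA.
case: z {c c0} => [[[] []] i] /=;
  rewrite /act /= !set_levelE !eqxx /lcoef /lmove /jwsign /= ?sg /site_move /shift /=.
- exists (((S a).1%:R) * jw a S * jw a S); split=> [|h].
    by case: (S a).1; rewrite ?mul0r ?eqxx // mul1r jw_sqr oner_neq0.
  by rewrite !set_set_level sg; ring.
- exists ((~~ (S a).1)%:R * jw a S); split=> [|h].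
    by case: (S a).1; rewrite ?mul0r ?eqxx // mul1r.
  by rewrite set_set_level addr0.
- exists ((S a).1%:R * jw a S); split=> [|h].
    by case: (S a).1; rewrite ?mul0r ?eqxx // mul1r.
  by rewrite set_set_level.
- exists ((~~ (S a).1)%:R * jw a S * jw a S); split=> [|h].
    by case: (S a).1; rewrite ?mul0r ?eqxx // mul1r jw_sqr oner_neq0.
  by rewrite !set_set_level sg; ring.
Qed.

Definition word_move (s : seq 'I_n) (f : 'I_n -> site) S : state :=
  [ffun b => if b \in s then site_move (f b) (S b) else S b].

Lemma ev_mword (s : seq 'I_n) (f : 'I_n -> site) S : uniq s -> exists d,
  (d != 0) = all (fun b => (S b).1 == (f b).1.2) s /\
  forall h, ev (mword s f) h S = d * h (word_move s f S).
Proof.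
elim: s => [|a s IHs] /=.
  exists 1; split=> [|h]; first by rewrite oner_neq0.
  by rewrite mul1r; congr h; apply/ffunP => b; rewrite ffunE.
case/andP=> as_ /IHs[d [hd e]].
have [d' [hd' e']] := ev_block a (f a) (word_move s f S).
have Sa : word_move s f S a = S a by rewrite ffunE (negPf as_).
rewrite Sa in hd' e'; exists (d * d'); split=> [|h].
  by rewrite mulf_eq0 negb_or hd hd' andbC.
rewrite [mword _ _]/= /mword /= ev_cat e e' mulrA; congr (_ * h _).
apply/ffunP => b; rewrite set_levelE !ffunE inE.
by case: eqP => // ->.
Qed.

Lemma basis_word_free (c : {ffun 'I_n -> site} -> K) :
  idl (cl_rels n k q) (fun phi => \sum_f c f * phi (basis_word f)) ->
  forall f, c f = 0.
Proof.
(* [S] has at each site the source of [f0], so that [f0] does not annihilate it; [h] then reads off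
   the coefficient of the image of [S] under [f0]. *)
move=> hc f0; pose S : state := [ffun b => ((f0 b).1.2, 0)].
pose h (S' : state) : K := (S' == word_move (enum 'I_n) f0 S)%:R.
have := ev_idl h S hc; have u := enum_uniq 'I_n.
rewrite (bigD1 f0) //= big1 ?addr0.
  have [d [hd e]] := ev_mword f0 S u; rewrite /basis_word e /h eqxx mulr1.
  move/eqP; rewrite mulf_eq0 => /orP[/eqP // | /idPn[]]; rewrite hd.
  by apply/allP => b _; rewrite ffunE.
move=> f ff0; have [d [hd e]] := ev_mword f S u; rewrite /basis_word e /h.
have [d0|d0] := eqVneq d 0; first by rewrite d0 mul0r mulr0.
case: eqP => [eS|]; last by rewrite !mulr0.
case/eqP: ff0; apply/ffunP => b.
have /allP/(_ b (mem_enum _ b)) : all (fun b => (S b).1 == (f b).1.2) (enum 'I_n).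
  by rewrite -hd.
rewrite ffunE /= => /eqP src.
have := congr1 (fun S' : state => S' b) eS.
rewrite /= !ffunE mem_enum /site_move /= !add0r => eb.
have /= tgt := congr1 fst eb; have /= := congr1 snd eb.
(* Equal sources and targets give equal shifts, which cancel and leave equal exponents of
   [omega]. *)
rewrite /shift; move: src tgt {eb}; case: (f b) (f0 b) => [[x y] i] [[x0 y0] i0] /=.
by move=> -> -> /(addIr _) ->.
Qed.

End Representation.

Theorem corollary3p5 (K : fieldType) (q : K) (n k : nat) :
  (2%:R : K) != 0 -> q != 0 -> (0 < n)%N -> (0 < k)%N ->
  quotient_dim_eq (cl_rels n k q) ((8 * k) ^ n)%N.
Proof.
move=> two_neq0 q_neq0 _ k_gt0.
apply: (@quotient_dim_words _ _ _ _ (@basis_word n k)).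
(* Each site contributes [2 * 2 * (2 * k)] choices; ['Z_(2 * k)] has [2 * k] elements because
   [2 * k] is at least 2. *)
- rewrite card_ffun card_ord !card_prod card_bool card_ord Zp_cast ?leq_pmulr //.
  by rewrite !mulnA.
- exact: spanned_word.
- exact: basis_word_free.
Qed.
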